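(* Let $q\ge1$ and $a$ be integers with $(a,q)=1$, let $j\ne0$ be an integer, and let $N\ge1$ and $R\ge1$ be real. Then $$\sum_{\substack{n\le N\\ n\equiv a\ (\mathrm{mod}\ q)}}\lambda_R(n)\lambda_R(n+jq)=\frac{N}{\phi(q)}\mathfrak S(jq)+O\Big(\frac{N g(q)}{\phi(q)R}\cdot\frac{|j|\,d(|j|)}{\phi(|j|)}\Big)+O(R^2).$$
   Context: $\phi$ is Euler's totient function, $\mu$ the Möbius function, $d(n)$ the number of positive divisors of $n$, and for any integer $n$ $$\lambda_R(n)=\sum_{r\le R}\frac{\mu^2(r)}{\phi(r)}\sum_{d\mid (r,n)}d\,\mu(d).$$ For a nonzero integer $k$, the singular series is $$\mathfrak S(k)=2C\prod_{p\mid k,\ p>2}\frac{p-1}{p-2}\ \text{ if }k\text{ is even},\qquad \mathfrak S(k)=0\ \text{ if }k\text{ is odd},\qquad C=\prod_{p>2}\Big(1-\frac1{(p-1)^2}\Big),$$ where $p$ denotes primes. Also $g(q)=\prod_{p\mid q}\big(1+\frac{p}{p-1}\big)$. The sum on the left is over positive integers $n$. Implied constants are absolute. *)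

(* Defs.v *)
From HB Require Import structures.
From mathcomp Require Export all_boot all_order all_algebra.
From mathcomp Require Export all_classical all_reals all_analysis.
Import Order.TTheory GRing.Theory Num.Theory.
Import numFieldNormedType.Exports.

Set Implicit Arguments.
Unset Strict Implicit.
Unset Printing Implicit Defensive.

Local Open Scope classical_set_scope.
Local Open Scope ring_scope.

(* The condition [0 < n] is needed because [primes 0 = [::]]. *)
Definition squarefree (n : nat) : bool :=
  (0 < n)%N && all (fun p => logn p n == 1%N) (primes n).

Definition moebius (n : nat) : int :=
  if squarefree n then (-1) ^+ size (primes n) else 0.

Definition num_divisors (n : nat) : nat := size (divisors n).

(* The inner sum runs over the common positive divisors of [r] and [n]; here
   [gcdn r 0 = r], so that [lambda_R Q 0] is also the intended value. *)
Definition lambda_R (K : realType) (Q : K) (n : int) : K :=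
  \sum_(1 <= r < (Num.truncn Q).+1)
    ((moebius r)%:~R ^+ 2 / (totient r)%:R) *
    \sum_(d <- divisors (gcdn r `|n|%N)) d%:R * (moebius d)%:~R.

Definition twin_prime_constant (K : realType) : K :=
  lim ((fun m : nat =>
    \prod_(3 <= p < m | prime p) (1 - 1 / (p%:R - 1) ^+ 2 : K)) @ \oo).

Definition singular_series (K : realType) (k : int) : K :=
  if (2 %| k)%Z then
    2 * twin_prime_constant K *
    \prod_(p <- primes `|k|%N | (2 < p)%N) ((p%:R - 1) / (p%:R - 2))
  else 0.

Definition g_factor (K : realType) (q : nat) : K :=
  \prod_(p <- primes q) (1 + p%:R / (p%:R - 1)).

(* Main.v *)
(** Write [L] for the product of the primes below a large bound [m]. Expanding
    both factors turns the correlation into a sum, over [r, s <= R] dividing [L]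
    and over [d | r], [e | s], of the number of [n <= N] with [n = a] mod [q],
    [d | n] and [e | n + jq]. By the Chinese remainder theorem this number is
    [N / (q lcm(d,e)) + O(1)] if [d], [e] are coprime to [q] and [gcd(d,e) | j],
    and is [0] otherwise. The [O(1)] terms contribute
    [(\sum_(r <= R) sigma(r) / phi(r))^2 = O(R^2)]. In the main term the sum
    over [d, e] factors over the primes dividing [L], so that extending [r, s]
    to all divisors of [L] yields a finite Euler product, which tends to
    [q / phi(q)] times the singular series as [m] grows. The price of the
    extension is at most twice the sum over [r > R] and all [s] of absolute
    values; for fixed [r] the sum over [s] is exactly [q / phi(q)] times a
    multiplicative function of [r], and what remains is bounded through
    [\sum_(r > y) mu^2(r) / phi(r)^2 = O(1 / y)] by adding the primes dividing
    [jq] one at a time. All bounds are uniform in [m]. *)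
From mathcomp Require Import ring lra zify.
Require Import Defs.
Import Order.TTheory GRing.Theory Num.Theory.
Import numFieldNormedType.Exports.
Set Implicit Arguments.
Unset Strict Implicit.
Unset Printing Implicit Defensive.
Local Open Scope classical_set_scope.
Local Open Scope ring_scope.

(** * Squarefree numbers and sums over their divisors *)

Lemma squarefree_gt0 n : squarefree n -> (0 < n)%N.
Proof. by case/andP. Qed.

Lemma squarefreeP n : (0 < n)%N ->
  reflect (forall p, prime p -> (logn p n <= 1)%N) (squarefree n).
Proof.
move=> n0; rewrite /squarefree n0; apply: (iffP allP) => /= h p.
  move=> pp; case: (boolP (p \in primes n)) => [/h/eqP -> //|].
  by rewrite -logn_gt0 lt0n negbK => /eqP ->.
move=> pn; have := pn; rewrite mem_primes => /andP[pp _].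
by rewrite eqn_leq h //= logn_gt0.
Qed.

Lemma squarefree_dvd d n : squarefree n -> (d %| n)%N -> squarefree d.
Proof.
move=> sn dn; have n0 := squarefree_gt0 sn; have d0 := dvdn_gt0 n0 dn.
apply/squarefreeP => // p pp; apply: leq_trans (dvdn_leq_log p n0 dn) _.
by move/(squarefreeP n0): sn; apply.
Qed.

Lemma squarefree_prod_primes n : squarefree n -> (\prod_(p <- primes n) p = n)%N.
Proof.
move=> sn; have n0 := squarefree_gt0 sn.
rewrite [RHS]prod_prime_decomp // prime_decompE big_map /=.
apply: eq_big_seq => p; case/andP: sn => _ /allP h /h /eqP ->.
by rewrite expn1.
Qed.

Lemma coprime_prime_sqf p D : prime p -> squarefree (p * D) -> coprime p D.
Proof.
move=> pp sf; have := squarefree_gt0 sf; rewrite muln_gt0 => /andP[p0 D0].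
rewrite prime_coprime // -[X in (X %| _)%N]expn1 pfactor_dvdn // -ltnNge ltnS.
move/squarefreeP: sf; rewrite muln_gt0 p0 D0 => /(_ isT p pp).
by rewrite lognM // logn_prime // eqxx add1n ltnS.
Qed.

(** Removing the least prime factor leaves a smaller squarefree number coprime to it, so
    multiplicative identities can be proved one prime at a time. *)
Lemma squarefree_ind (P : nat -> Prop) :
  P 1%N ->
  (forall p D, prime p -> coprime p D -> squarefree D -> P D -> P (p * D)%N) ->
  forall D, squarefree D -> P D.
Proof.
move=> P1 PS D; have [m] := ubnP D; elim: m D => // m IH D Dm sD.
have D0 := squarefree_gt0 sD.
case: (ltngtP D 1%N) => [|D1|-> //]; first by rewrite ltnS leqNgt D0.
have pp := pdiv_prime D1; have E : D = (pdiv D * (D %/ pdiv D))%N.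
  by rewrite mulnC divnK // pdiv_dvd.
have sD' : squarefree (D %/ pdiv D).
  by apply: squarefree_dvd sD _; apply/dvdnP; exists (pdiv D).
rewrite E; apply: PS => //; first by apply: coprime_prime_sqf => //; rewrite -E.
apply: IH => //; apply: leq_trans (ltn_Pdiv (prime_gt1 pp) D0) _.
by rewrite -ltnS.
Qed.

Lemma perm_primesM p D : prime p -> coprime p D -> (0 < D)%N ->
  perm_eq (primes (p * D)) (p :: primes D).
Proof.
move=> pp cpD D0; apply: uniq_perm; rewrite ?primes_uniq //=.
  by rewrite primes_uniq andbT mem_primes pp D0 /= -prime_coprime.
by move=> x; rewrite primesM ?(prime_gt0 pp) // primes_prime // !inE.
Qed.

Lemma perm_divisorsM p D : prime p -> coprime p D -> (0 < D)%N ->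
  perm_eq (divisors (p * D)) (divisors D ++ [seq (p * d)%N | d <- divisors D]).
Proof.
move=> pp cpD D0; have p0 := prime_gt0 pp.
apply: uniq_perm; rewrite ?divisors_uniq //.
  rewrite cat_uniq divisors_uniq map_inj_uniq ?divisors_uniq ?andbT /=; last first.
    by move=> x y /eqP; rewrite eqn_pmul2l // => /eqP.
  apply/hasPn => _ /mapP[d _ ->]; rewrite -dvdn_divisors //.
  apply/negP => /(dvdn_trans (dvdn_mulr d (dvdnn p))).
  by apply/negP; rewrite -prime_coprime.
move=> x; rewrite mem_cat -!dvdn_divisors ?muln_gt0 ?p0 //.
apply/idP/orP => [xpD|[xD|/mapP[d]]]; last 2 first.
- exact: dvdn_mull.
- by rewrite -dvdn_divisors // => dD ->; rewrite dvdn_pmul2l.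
case: (boolP (p %| x)%N) => [/dvdnP[y E]|px].
  right; apply/mapP; exists y; last by rewrite mulnC.
  by move: xpD; rewrite E mulnC dvdn_pmul2l // -dvdn_divisors.
by left; rewrite -(@Gauss_dvdr _ p) // coprime_sym prime_coprime.
Qed.

Lemma squarefreeM p D : prime p -> coprime p D -> squarefree D -> squarefree (p * D).
Proof.
move=> pp cpD sD; have D0 := squarefree_gt0 sD; have p0 := prime_gt0 pp.
apply/squarefreeP => [|x px]; first by rewrite muln_gt0 p0.
rewrite lognM // logn_prime //; case: eqP => [->|_].
  by rewrite logn_coprime.
by move/(squarefreeP D0): sD; apply.
Qed.

Lemma big_divisorsM (K : nmodType) (F : nat -> K) p D :
  prime p -> coprime p D -> (0 < D)%N ->
  \sum_(d <- divisors (p * D)) F d =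
  \sum_(d <- divisors D) F d + \sum_(d <- divisors D) F (p * d)%N.
Proof.
move=> pp cpD D0.
by rewrite (perm_big _ (perm_divisorsM pp cpD D0)) /= big_cat big_map.
Qed.

Lemma coprime_mem_primes p q D : coprime p D -> q \in primes D -> prime p -> p != q.
Proof.
move=> cpD; rewrite mem_primes => /and3P[_ _ qD] pp; apply/eqP => E.
by move: cpD; rewrite prime_coprime // E qD.
Qed.

(** Divisors of a squarefree number correspond to sets of its primes, so this is distributivity.
    Every Euler factorisation below rests on it. *)
Lemma sum_div_prod (K : comNzRingType) (F : nat -> bool -> K) D : squarefree D ->
  \sum_(d <- divisors D) \prod_(p <- primes D) F p (p %| d)%N =
  \prod_(p <- primes D) (F p false + F p true).
Proof.
move=> sD; elim/squarefree_ind: D / sD => [|p D pp cpD sD IH].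
  by rewrite (_ : divisors 1 = [:: 1%N]) // big_seq1 !big_nil.
have D0 := squarefree_gt0 sD.
rewrite big_divisorsM // (perm_big _ (perm_primesM pp cpD D0)) /= big_cons -IH.
rewrite mulrDl !big_distrr /=; congr (_ + _); apply: eq_big_seq => d dD;
    rewrite (perm_big _ (perm_primesM pp cpD D0)) /= big_cons.
- congr (_ * _); congr (F p _); apply/negbTE/negP => pd.
  move: cpD; rewrite prime_coprime //.
  by move/negP; apply; apply: dvdn_trans pd _; rewrite dvdn_divisors.
- rewrite dvdn_mulr //; congr (_ * _); apply: eq_big_seq => q qD.
  rewrite Euclid_dvdM; last by move: qD; rewrite mem_primes => /andP[].
  rewrite (_ : (q %| p)%N = false) //; apply/negP => qp.
  have := coprime_mem_primes cpD qD pp; move: qp.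
  rewrite dvdn_prime2 // ?(eq_sym p) => [->|] //.
  by move: qD; rewrite mem_primes => /andP[].
Qed.

(** Moves products over different divisors to one common index set, where they can be multiplied
    factor by factor. *)
Lemma prod_primes_dvd (K : comNzRingType) (F : nat -> K) d D : (0 < D)%N -> (d %| D)%N ->
  \prod_(p <- primes d) F p = \prod_(p <- primes D) (if (p %| d)%N then F p else 1).
Proof.
move=> D0 dD; have d0 := dvdn_gt0 D0 dD.
rewrite -big_mkcond -[RHS]big_filter; apply: perm_big; apply: uniq_perm.
- exact: primes_uniq.
- by rewrite filter_uniq // primes_uniq.
- move=> p; rewrite mem_filter !mem_primes D0 d0 /=.
  case: (boolP (p %| d)%N) => [pd|]; rewrite ?andbF //=.
  by rewrite (dvdn_trans pd dD) andbT.
Qed.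

Lemma sum_dvd (K : nmodType) (F : nat -> K) r D : (0 < D)%N -> (r %| D)%N ->
  \sum_(d <- divisors r) F d = \sum_(d <- divisors D | (d %| r)%N) F d.
Proof.
move=> D0 rD; have r0 := dvdn_gt0 D0 rD.
rewrite -[RHS]big_filter; apply: perm_big; apply: uniq_perm.
- exact: divisors_uniq.
- by rewrite filter_uniq // divisors_uniq.
- move=> p; rewrite mem_filter -!dvdn_divisors //.
  by case: (boolP (p %| r)%N) => // pr; rewrite (dvdn_trans pr rD).
Qed.

(** * Arithmetic functions of squarefree numbers as products over primes *)

Lemma natr_all_primes (K : comNzRingType) (P : pred nat) d :
  ((all P (primes d))%:R : K) = \prod_(p <- primes d) (P p)%:R.
Proof.
elim: (primes d) => [|p s IH]; first by rewrite big_nil.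
by rewrite big_cons /= -IH -mulnb natrM.
Qed.

Lemma sqf_natr (K : comNzRingType) m : squarefree m ->
  (m%:R : K) = \prod_(p <- primes m) p%:R.
Proof. by move=> sm; rewrite -[in LHS](squarefree_prod_primes sm) natr_prod. Qed.

Lemma sqf_totient (K : comNzRingType) m : squarefree m ->
  ((totient m)%:R : K) = \prod_(p <- primes m) (p%:R - 1).
Proof.
elim/squarefree_ind => [|p D pp cpD sD IH]; first by rewrite big_nil.
rewrite (perm_big _ (perm_primesM pp cpD (squarefree_gt0 sD))) /= big_cons -IH.
by rewrite totient_coprime // totient_prime // natrM -subn1 natrB ?prime_gt0.
Qed.

Lemma sqf_moebius (K : comNzRingType) m : squarefree m ->
  ((moebius m)%:~R : K) = \prod_(p <- primes m) (-1).
Proof.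
rewrite /moebius => ->; rewrite rmorphXn /= rmorphN1.
by elim: (primes m) => [|p s IH]; rewrite ?big_nil // big_cons -IH /= exprS.
Qed.

Lemma sqf_dvd m n : squarefree m -> (m %| n)%N = all (fun p => p %| n)%N (primes m).
Proof.
elim/squarefree_ind => [|p D pp cpD sD IH]; first by rewrite dvd1n.
rewrite (perm_all _ (perm_primesM pp cpD (squarefree_gt0 sD))) /= -IH.
by rewrite Gauss_dvd.
Qed.

Lemma sqf_coprime m n : squarefree m ->
  coprime m n = all (fun p => ~~ (p %| n)%N) (primes m).
Proof.
elim/squarefree_ind => [|p D pp cpD sD IH]; first by rewrite coprime1n.
rewrite (perm_all _ (perm_primesM pp cpD (squarefree_gt0 sD))) /= -IH.
by rewrite coprimeMl prime_coprime.
Qed.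

Lemma prime_in_primes p n : p \in primes n -> prime p.
Proof. by rewrite mem_primes => /andP[]. Qed.

(* The factor at [p] of the sum over [d | r], [e | s] of
   [mu(d) mu(e) gcd(d, e)], restricted to [d], [e] coprime to [q] with
   [gcd(d, e) | j]; the booleans say whether [p | r] and whether [p | s]. *)
Definition local_corr (K : comNzRingType) (q j p : nat) (b b' : bool) : K :=
  if b && b' then (if (p %| q)%N then 1 else p%:R *+ (p %| j)%N - 1)
  else if b || b' then (p %| q)%N%:R else 1.

(** Each summand is a product over the primes of [L] of a term depending only on whether [p] divides
    [d] and [e]; applying [sum_div_prod] in [e] and then in [d] factors the sum. *)
Lemma sum_moebius_gcd (K : comNzRingType) (L q j r s : nat) :
  squarefree L -> (r %| L)%N -> (s %| L)%N ->
  \sum_(d <- divisors r) \sum_(e <- divisors s)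
     (moebius d)%:~R * (moebius e)%:~R * (gcdn d e)%:R *
     ([&& coprime d q, coprime e q & gcdn d e %| j]%N)%:R
  = \prod_(p <- primes L) local_corr K q j p (p %| r)%N (p %| s)%N :> K.
Proof.
move=> sL rL sL'; have L0 := squarefree_gt0 sL.
(* The indicators of [p %| r] and [p %| s] enforce [d %| r] and [e %| s], so that both sums can run
   over all divisors of [L]. *)
pose u p (b b' : bool) : K :=
  (if b then - (p %| r)%N%:R * (~~ (p %| q)%N)%:R else 1) *
  (if b' then - (p %| s)%N%:R * (~~ (p %| q)%N)%:R else 1) *
  (if b && b' then p%:R * (p %| j)%N%:R else 1).
have -> : \sum_(d <- divisors r) \sum_(e <- divisors s)
     (moebius d)%:~R * (moebius e)%:~R * (gcdn d e)%:R *
     ([&& coprime d q, coprime e q & gcdn d e %| j]%N)%:R =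
   \sum_(d <- divisors L) \sum_(e <- divisors L) \prod_(p <- primes L)
      u p (p %| d)%N (p %| e)%N :> K.
  rewrite (sum_dvd _ L0 rL) big_mkcond; apply: eq_big_seq => d.
  rewrite -dvdn_divisors // => dL; have sd := squarefree_dvd sL dL.
  rewrite (sum_dvd _ L0 sL').
  have -> : forall x y : K, (if (d %| r)%N then x else y) =
     (d %| r)%N%:R * x + (~~ (d %| r)%N)%:R * y.
    by move=> x y; case: ifP => _ /=; ring.
  rewrite mulr0 addr0 big_mkcond big_distrr /=; apply: eq_big_seq => e.
  rewrite -dvdn_divisors // => eL; have se := squarefree_dvd sL eL.
  have -> : forall x y : K, (if (e %| s)%N then x else y) =
     (e %| s)%N%:R * x + (~~ (e %| s)%N)%:R * y.
    by move=> x y; case: ifP => _ /=; ring.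
  have gL : (gcdn d e %| L)%N by apply: dvdn_trans dL; apply: dvdn_gcdl.
  have sg := squarefree_dvd sL gL.
  rewrite mulr0 addr0 -!mulnb !natrM.
  rewrite !sqf_dvd // !sqf_coprime // !natr_all_primes !sqf_moebius // (sqf_natr _ sg).
  rewrite !(prod_primes_dvd _ L0 dL) !(prod_primes_dvd _ L0 eL).
  rewrite !(prod_primes_dvd _ L0 gL) -!big_split /=. apply: eq_bigr => p _.
  rewrite /u dvdn_gcd; case: (p %| d)%N; case: (p %| e)%N => /=; ring.
transitivity (\sum_(d <- divisors L) \prod_(p <- primes L)
    (u p (p %| d)%N false + u p (p %| d)%N true)).
  apply: eq_bigr => d _.
  exact: (sum_div_prod (fun p b' => u p (p %| d)%N b') sL).
rewrite (sum_div_prod (fun p b => u p b false + u p b true) sL).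
apply: eq_bigr => p _; rewrite /u /local_corr -mulr_natr.
by case: (p %| r)%N; case: (p %| s)%N; case: (p %| q)%N => /=; ring.
Qed.

(** * Counting in residue classes *)

(** As [x < M], no positive multiple of [M] is lost below the range from [x + 1] to [x + n]. *)
Lemma count_dvdn_shift (M x n : nat) : (x < M)%N ->
  (\sum_(1 <= i < n.+1) (M %| i + x) = (n + x) %/ M)%N.
Proof.
move=> xM; have M0 : (0 < M)%N by apply: leq_ltn_trans xM.
elim: n => [|n IH]; first by rewrite big_geq // add0n divn_small.
by rewrite big_nat_recr //= IH addSn divnS // addnC.
Qed.

(** With [x] the residue of [- c], the count is the integer part of [(n + x) / M]. It is within 1 of
    [n / M], and replacing [n] by [N] costs at most 1 more. *)
Lemma count_modz (K : realType) (M : nat) (c : int) (n : nat) (N : K) :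
  (0 < M)%N -> n%:R <= N < n.+1%:R ->
  `| \sum_(1 <= i < n.+1) ((i%:Z == c %[mod M%:Z])%Z)%:R - N / M%:R | <= 2.
Proof.
move=> M0 /andP[nN Nn]; pose x := `|((- c) %% M)%Z|%N.
have Mz : M%:Z != 0 by lia.
have xE : x%:Z = ((- c) %% M)%Z by rewrite /x gez0_abs // modz_ge0.
have xM : (x < M)%N by rewrite -ltz_nat xE ltz_pmod.
have -> : \sum_(1 <= i < n.+1) ((i%:Z == c %[mod M%:Z])%Z)%:R = ((n + x) %/ M)%N%:R :> K.
  rewrite -(count_dvdn_shift n xM) natr_sum; apply: eq_bigr => i _.
  congr (_%:R); congr nat_of_bool; rewrite eqz_mod_dvd.
  have -> : (M %| i + x)%N = (M%:Z %| i%:Z + x%:Z)%Z by rewrite dvdzE.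
  have := divz_eq (- c) M; rewrite -xE => E.
  have -> : i%:Z - c = (i%:Z + x%:Z) + ((- c) %/ M)%Z * M%:Z.
    by move: E; set w := (_ %/ _)%Z => ->; ring.
  by rewrite rpredDr // dvdz_mull.
have MR : 0 < M%:R :> K by rewrite ltr0n.
set k := ((n + x) %/ M)%N; have E := divn_eq (n + x) M.
have tM := ltn_pmod (n + x) M0; set t := ((n + x) %% M)%N in E tM *.
have : n%:R + x%:R = k%:R * M%:R + t%:R :> K by rewrite -!natrD -natrM -natrD -E.
move=> ER; have xR : x%:R <= M%:R :> K by rewrite ler_nat ltnW.
have tR : t%:R <= M%:R :> K by rewrite ler_nat ltnW.
have x0 : 0 <= x%:R :> K by []; have t0 : 0 <= t%:R :> K by [].
have M1 : 1 <= M%:R :> K by rewrite ler1n.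
rewrite -natr1 in Nn.
rewrite ler_norml; apply/andP; split.
  rewrite lerBrDr addrC -lerBrDr opprK ler_pdivrMr // mulrDl; lra.
rewrite lerBlDr -lerBlDl ler_pdivlMr // mulrBl; lra.
Qed.

Lemma exists_common_residue (q d e : nat) (a j : int) :
  coprime d q -> coprime e q -> (gcdn d e %| `|j|)%N ->
  exists n0 : int, [/\ (n0 = a %[mod q])%Z, (d %| n0)%Z & (e %| n0 + j * q)%Z].
Proof.
move=> dq eq gj; have [u [v uv]] : exists u v : int, u * d + v * e = (gcdn d e)%:Z.
  by have [u [v uv]] := Bezoutz d%:Z e%:Z; exists u, v.
have [k kE] : exists k, j = k * (gcdn d e)%:Z by apply/dvdzP; rewrite dvdzE.
have cl : coprimez q (lcmn d e).
  rewrite coprimezE /= coprime_sym; apply: coprime_dvdl (_ : coprime (d * e) q).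
    by rewrite dvdn_lcm dvdn_mulr // dvdn_mull.
  by rewrite coprimeMl dq.
(* [m] is a multiple of [d], and by Bezout [m + j * q = k * v * q * e] is a multiple of [e]. The
   Chinese remainder theorem then adds the condition modulo [q]. *)
pose m := - (u * d%:Z * k * q); pose n0 := zchinese q (lcmn d e) a m.
have : ((lcmn d e)%:Z %| n0 - m)%Z.
  by rewrite -eqz_mod_dvd; apply/eqP; apply: zchinese_modr.
move=> lm; exists n0; split; first exact: zchinese_modl.
  rewrite -(subrK m n0) rpredD //.
    by apply: dvdz_trans lm; rewrite dvdzE /= dvdn_lcml.
  by rewrite /m rpredN -mulrA [u * _]mulrC -!mulrA dvdz_mulr.
rewrite -(subrK m n0) -addrA rpredD //.
  by apply: dvdz_trans lm; rewrite dvdzE /= dvdn_lcmr.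
apply/dvdzP; exists (k * v * q); rewrite /m kE -uv; ring.
Qed.

(** In the compatible case the conditions describe one class modulo [q * lcmn d e]. Otherwise no [i]
    qualifies: a common solution is coprime to [q], which makes [d] and [e] coprime to [q], and
    [gcdn d e] divides [j * q], hence [j]. *)
Lemma count_corr (K : realType) (q d e : nat) (a j : int) (n : nat) (N : K) :
  (0 < q)%N -> (0 < d)%N -> (0 < e)%N -> coprimez a q ->
  n%:R <= N < n.+1%:R ->
  `| \sum_(1 <= i < n.+1 | (i%:Z == a %[mod q%:Z])%Z)
       (d %| i)%N%:R * (e %| `|(i%:Z + j * q%:Z)%R|)%N%:R
     - ([&& coprime d q, coprime e q & gcdn d e %| `|j|]%N)%:R *
       (N / (q * lcmn d e)%N%:R) | <= 2.
Proof.
move=> q0 d0 e0 caq nN; case: (boolP (_ && _)) => /= [/and3P[dq eq gj]|nc].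
  have [n0 [n0a dn0 en0]] := exists_common_residue a dq eq gj.
  rewrite mul1r big_mkcond /=.
  have M0 : (0 < q * lcmn d e)%N by rewrite muln_gt0 q0 lcmn_gt0 d0.
  have := count_modz n0 M0 nN; congr (`|_ - _| <= _); apply: eq_bigr => i _.
  have -> : (i%:Z == n0 %[mod (q * lcmn d e)%N%:Z])%Z =
     [&& (i%:Z == a %[mod q%:Z])%Z, (d %| i)%N & (e %| `|(i%:Z + j * q%:Z)%R|)%N].
    rewrite eqz_mod_dvd dvdzE /= Gauss_dvd; last first.
      rewrite coprime_sym; apply: coprime_dvdl (_ : coprime (d * e) q).
        by rewrite dvdn_lcm dvdn_mulr // dvdn_mull.
      by rewrite coprimeMl dq.
    rewrite dvdn_lcm; congr [&& _, _ & _].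
    - by rewrite -n0a eqz_mod_dvd dvdzE.
    - rewrite -[LHS]/(d%:Z %| i%:Z - n0)%Z -[RHS]/(d%:Z %| i%:Z)%Z.
      by rewrite rpredBr.
    - rewrite -[LHS]/(e%:Z %| i%:Z - n0)%Z -[RHS]/(e%:Z %| i%:Z + j * q)%Z.
      have -> : i%:Z - n0 = (i%:Z + j * q) - (n0 + j * q) by ring.
      by rewrite rpredBr.
  by case: ifP => _ //=; rewrite -natrM mulnb.
rewrite mul0r subr0 big1 ?normr0 // => i ia.
case: (boolP (d %| i)%N) => di; last by rewrite mul0r.
case: (boolP (e %| _)%N) => ei; last by rewrite mulr0.
move/negP: nc => []; 
have ciq : coprimez i q by rewrite /coprimez -gcdz_modl (eqP ia) gcdz_modl.
have ceq : coprimez (i%:Z + j * q) q.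
  by rewrite /coprimez -gcdz_modl addrC modzMDl gcdz_modl.
have dq : coprime d q by apply: coprime_dvdl di _.
have eq : coprime e q by apply: coprime_dvdl ei _; rewrite coprimezE in ceq.
rewrite dq eq /=.
have gq : coprime (gcdn d e) q by apply: coprime_dvdl dq; rewrite dvdn_gcdl.
rewrite -(Gauss_dvdl _ gq).
have : ((gcdn d e)%:Z %| (i%:Z + j * q) - i%:Z)%Z.
  rewrite rpredB // dvdzE /=; last by apply: dvdn_trans di; apply: dvdn_gcdl.
  by apply: dvdn_trans ei; apply: dvdn_gcdr.
by rewrite addrC addKr dvdzE abszM.
Qed.

(** * Uniform bounds for sums over squarefree numbers *)

Lemma squarefree_prod_seq (s : seq nat) : uniq s -> all prime s ->
  squarefree (\prod_(p <- s) p)%N /\ perm_eq (primes (\prod_(p <- s) p)%N) s.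
Proof.
elim: s => [|p s IH] /=; first by rewrite big_nil.
move=> /andP[ps us] /andP[pp als]; have [sf pe] := IH us als.
have cop : coprime p (\prod_(p <- s) p)%N.
  rewrite prime_coprime //; apply: contra ps => pd.
  by rewrite -(perm_mem pe) mem_primes pp squarefree_gt0.
rewrite big_cons; split; first exact: squarefreeM.
apply: perm_trans (perm_primesM pp cop (squarefree_gt0 sf)) _.
by rewrite perm_cons.
Qed.

Lemma ler_sum_subset (K : realType) (s t : seq nat) (F : nat -> K) :
  uniq s -> uniq t -> {subset s <= t} -> (forall n, 0 <= F n) ->
  \sum_(n <- s) F n <= \sum_(n <- t) F n.
Proof.
move=> us ut st F0.
have pe : perm_eq s [seq n <- t | n \in s].
  apply: uniq_perm; rewrite ?filter_uniq // => x; rewrite mem_filter.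
  by case: (boolP (x \in s)) => // /st.
rewrite (perm_big _ pe) big_filter big_mkcond /=; apply: ler_sum => n _.
by case: ifP.
Qed.

Lemma prime_pred_gt0 (K : realType) p : prime p -> 0 < p%:R - 1 :> K.
Proof. by move=> pp; rewrite subr_gt0 ltr1n prime_gt1. Qed.

Lemma sum_inv_sqr_tail (K : realType) (z : K) n : 0 < z ->
  \sum_(1 <= k < n | z < k%:R) (k%:R ^+ 2)^-1 <= 2 / z.
Proof.
(* Strengthened so that induction telescopes through [1 / k^2 <= 2 / k - 2 / (k + 1)]; the value 0
   covers the range before [z], where the sum is empty. *)
move=> z0; suff : \sum_(1 <= k < n.+1 | z < k%:R) (k%:R ^+ 2)^-1 <=
    if z < n.+1%:R then 2 / z - 2 / n.+1%:R else 0.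
  case: n => [_|n]; first by rewrite big_geq // divr_ge0 // ltW.
  move=> h; apply: le_trans (_ : _ <= \sum_(1 <= k < n.+2 | z < k%:R) (k%:R ^+ 2)^-1) _.
    rewrite [leRHS]big_mkcond big_nat_recr //= -big_mkcond lerDl.
    by case: ifP => //; rewrite invr_ge0 sqr_ge0.
  apply: le_trans h _; case: ifP => _; last by rewrite divr_ge0 // ltW.
  by rewrite gerBl divr_ge0.
elim: n => [|n IH].
  rewrite big_geq //; case: ifP => // h; rewrite subr_ge0 divr1.
  by rewrite ler_pdivlMr // ler_piMr // ltW.
rewrite big_mkcond big_nat_recr //= -big_mkcond.
set S := (X in X + _); have := IH; rewrite -/S => {}IH.
have n1 : 0 < n.+1%:R :> K by rewrite ltr0n.
have E : n.+2%:R = n.+1%:R + 1 :> K by rewrite natr1.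
case: ifP => zn.
  rewrite zn in IH; have -> : z < n.+2%:R by apply: lt_trans zn _; rewrite ltr_nat.
  apply: le_trans (lerD IH (lexx _)) _; rewrite -addrA lerD2l E.
  rewrite -subr_ge0.
  have -> : - (2 / (n.+1%:R + 1)) - (- (2 / n.+1%:R) + (n.+1%:R ^+ 2)^-1)
     = (n.+1%:R - 1) / (n.+1%:R ^+ 2 * (n.+1%:R + 1)) :> K.
    by field; rewrite !gt_eqF // addr_gt0.
  apply: divr_ge0; first by rewrite subr_ge0 ler1n.
  by rewrite mulr_ge0 ?sqr_ge0 // addr_ge0 // ltW.
rewrite zn in IH; rewrite addr0; apply: le_trans IH _; case: ifP => // zn2.
by rewrite subr_ge0 ler_pM2l // lef_pV2 // ?posrE ?ltr0n // ltW.
Qed.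

(* [p_excess p] is the value at [p] of the Dirichlet factor [h] with
   [(m / phi m)^2 = \sum_(d %| m) h d] for squarefree [m]. *)
Definition p_excess (K : realType) (p : nat) : K := (p%:R / (p%:R - 1)) ^+ 2 - 1.

(** An absolute bound for the product of the factors [1 + p_excess K p / p]. *)
Definition euler_bound (K : realType) : K := expR 8.

(** By [1 + x <= expR x] it suffices to bound the sum of [2 / (p - 1)^2]; the numbers [p - 1] are
    distinct positive integers, so a sum of inverse squares dominates. *)
Lemma prod_excess_le (K : realType) L :
  \prod_(p <- primes L) (1 + p_excess K p / p%:R) <= euler_bound K.
Proof.
(* The threshold 1/2 in [sum_inv_sqr_tail] lies below 1, so every positive integer is included. *)
have -> : euler_bound K = expR (2 * (2 / 2^-1)) by congr expR; field.
apply: le_trans (_ : _ <= expR (\sum_(p <- primes L) 2 / (p%:R - 1) ^+ 2)) _.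
  rewrite expR_sum big_seq [leRHS]big_seq; apply: ler_prod => p pL.
  have pp := prime_in_primes pL; have p1 := prime_pred_gt0 K pp.
  have p0 : 0 < p%:R :> K by rewrite ltr0n prime_gt0.
  have E : p_excess K p / p%:R = 2 / (p%:R - 1) ^+ 2 - 1 / (p%:R * (p%:R - 1) ^+ 2).
    by rewrite /p_excess; field; rewrite !gt_eqF.
  apply/andP; split.
    rewrite addr_ge0 // divr_ge0 ?ler0n // subr_ge0 expr_ge1 //.
      by rewrite ler_pdivlMr // mul1r gerBl.
    by rewrite divr_ge0 // ltW.
  apply: le_trans (expR_ge1Dx _); rewrite lerD2l E gerBl.
  by rewrite divr_ge0 // mulr_ge0 // ?sqr_ge0 // ltW.
rewrite ler_expR -mulr_sumr ler_pM2l //.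
apply: le_trans (@sum_inv_sqr_tail K 2^-1 L.+1 _); last by rewrite invr_gt0.
rewrite [leRHS]big_mkcond /=.
rewrite (eq_big_seq (fun p => (p.-1%:R ^+ 2)^-1)); last first.
  move=> p /prime_in_primes/prime_gt0 p0 /=; by rewrite -subn1 natrB.
rewrite -(big_map predn predT (fun n => (n%:R ^+ 2)^-1)).
apply: le_trans (_ : _ <= \sum_(1 <= i < L.+1) (i%:R ^+ 2)^-1) _.
  apply: ler_sum_subset; rewrite ?iota_uniq //.
  - rewrite map_inj_in_uniq ?primes_uniq // => x y.
    by move=> /prime_in_primes/prime_gt0 ? /prime_in_primes/prime_gt0 ?; lia.
  - move=> _ /mapP[p pL ->]; have /prime_gt1 := prime_in_primes pL.
    have : (p <= L)%N.
      by move: pL; rewrite mem_primes => /and3P[_ L0 /dvdn_leq]; apply.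
    by rewrite mem_index_iota; lia.
rewrite big_seq [leRHS]big_seq; apply: ler_sum => i.
rewrite mem_index_iota => /andP[i1 _].
rewrite ifT //; apply: lt_le_trans (_ : 1 <= _); last by rewrite ler1n.
by rewrite invf_lt1 // ltr1n.
Qed.

Lemma sum_div_mult (K : comNzRingType) (F : nat -> K) D : squarefree D ->
  \sum_(d <- divisors D) \prod_(p <- primes d) F p = \prod_(p <- primes D) (1 + F p).
Proof.
move=> sD; have D0 := squarefree_gt0 sD.
rewrite -(sum_div_prod (fun p b => if b then F p else 1) sD).
apply: eq_big_seq => d; rewrite -dvdn_divisors // => dD.
exact: prod_primes_dvd.
Qed.

Lemma sqf_ratio (K : realType) m : squarefree m ->
  m%:R / (totient m)%:R = \prod_(p <- primes m) (p%:R / (p%:R - 1)) :> K.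
Proof. by move=> sm; rewrite (sqf_natr _ sm) sqf_totient // -prodf_div. Qed.

(** Expanding [(m / totient m)^2] as the sum of [H d] over [d %| m] and exchanging sums leaves [B]
    times the sum of [H d / d], a bounded Euler product. *)
Lemma sum_sqr_ratio_le (K : realType) (w : nat -> K) (B : K) L :
  squarefree L -> (forall n, 0 <= w n) ->
  (forall d, (0 < d)%N -> \sum_(1 <= m < L.+1 | (d %| m)%N) w m <= B / d%:R) ->
  \sum_(m <- divisors L) w m * (m%:R / (totient m)%:R) ^+ 2 <= euler_bound K * B.
Proof.
move=> sL w0 hw; have L0 := squarefree_gt0 sL.
pose H d := \prod_(p <- primes d) p_excess K p.
have H0 d : 0 <= H d.
  rewrite /H big_seq; apply: prodr_ge0 => p /prime_in_primes pp.
  have p1 := prime_pred_gt0 K pp.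
  rewrite subr_ge0 expr_ge1 //; first by rewrite ler_pdivlMr // mul1r gerBl.
  by rewrite divr_ge0 // ltW.
have B0 : 0 <= B.
  have := hw 1%N isT; rewrite divr1; apply: le_trans.
  by apply: sumr_ge0.
have E m : (m %| L)%N ->
   (m%:R / (totient m)%:R) ^+ 2 = \sum_(d <- divisors L | (d %| m)%N) H d.
  move=> mL; have sm := squarefree_dvd sL mL; have m0 := squarefree_gt0 sm.
  rewrite -(sum_dvd _ L0 mL) /H sum_div_mult // sqf_ratio // -prodrXl.
  by apply: eq_bigr => p _; rewrite /p_excess [RHS]addrC subrK.
rewrite (eq_big_seq (fun m => \sum_(d <- divisors L | (d %| m)%N) w m * H d)); last first.
  by move=> m; rewrite -dvdn_divisors // => mL; rewrite E // mulr_sumr.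
under eq_bigr do rewrite big_mkcond.
rewrite exchange_big /=.
apply: le_trans (_ : _ <= \sum_(d <- divisors L) H d * (B / d%:R)) _.
  rewrite big_seq [leRHS]big_seq; apply: ler_sum => d.
  rewrite -dvdn_divisors // => dL; have d0 := dvdn_gt0 L0 dL.
  rewrite -big_mkcond -mulr_suml mulrC ler_wpM2l //.
  apply: le_trans (hw d d0); rewrite !(big_mkcond (fun m => (d %| m)%N)).
  apply: ler_sum_subset; rewrite ?divisors_uniq ?iota_uniq //.
    move=> m; rewrite -dvdn_divisors // mem_index_iota => mL.
    by rewrite (dvdn_gt0 L0 mL) ltnS dvdn_leq.
  by move=> n; case: ifP.
have -> : \sum_(d <- divisors L) H d * (B / d%:R) =
   B * \prod_(p <- primes L) (1 + p_excess K p / p%:R).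
  rewrite -(sum_div_mult (fun p => p_excess K p / p%:R) sL) mulr_sumr.
  apply: eq_big_seq => d; rewrite -dvdn_divisors // => dL.
  by rewrite prodf_div -(sqf_natr _ (squarefree_dvd sL dL)) mulrCA.
by rewrite mulrC ler_wpM2r // prod_excess_le.
Qed.

Lemma sum_sqr_ratio_upto (K : realType) L x : squarefree L ->
  \sum_(m <- divisors L | (m <= x)%N) (m%:R / (totient m)%:R) ^+ 2
    <= euler_bound K * x%:R.
Proof.
move=> sL; pose w m : K := (m <= x)%N%:R.
have -> : \sum_(m <- divisors L | (m <= x)%N) (m%:R / (totient m)%:R) ^+ 2 =
    \sum_(m <- divisors L) w m * (m%:R / (totient m)%:R) ^+ 2 :> K.
  rewrite big_mkcond; apply: eq_bigr => m _.
  by rewrite /w; case: ifP; rewrite ?mul1r ?mul0r.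
apply: sum_sqr_ratio_le => // d d0.
rewrite big_mkcond /=.
apply: le_trans (_ : _ <= \sum_(m <- index_iota 1 L.+1 | (m <= x)%N) (d %| m)%N%:R) _.
  rewrite [leRHS]big_mkcond; apply: ler_sum => i _.
  by rewrite /w; case: (d %| i)%N; case: (i <= x)%N.
rewrite -big_filter.
apply: le_trans (_ : _ <= \sum_(1 <= i < x.+1) (d %| i)%N%:R) _.
  apply: ler_sum_subset; rewrite ?filter_uniq ?iota_uniq // => i.
  by rewrite mem_filter !mem_index_iota ltnS; lia.
rewrite -natr_sum; have := count_dvdn_shift x d0.
under eq_bigr do rewrite addn0.
by move=> ->; rewrite addn0 ler_pdivlMr ?ltr0n // -natrM ler_nat leq_trunc_div.
Qed.

(** The weight is [1 / m^2] beyond [y]. On the multiples of [d] it has mass at most [d^-2] times the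
    tail beyond [y / d], that is [(2 / y) / d]. *)
Lemma sum_inv_sqr_totient_tail (K : realType) L (y : K) : squarefree L -> 0 < y ->
  \sum_(m <- divisors L | y < m%:R) ((totient m)%:R ^+ 2)^-1 <= euler_bound K * (2 / y).
Proof.
move=> sL y0; have L0 := squarefree_gt0 sL.
pose w m : K := if y < m%:R then (m%:R ^+ 2)^-1 else 0.
have -> : \sum_(m <- divisors L | y < m%:R) ((totient m)%:R ^+ 2)^-1 =
    \sum_(m <- divisors L) w m * (m%:R / (totient m)%:R) ^+ 2.
  rewrite big_mkcond; apply: eq_big_seq => m.
  rewrite -dvdn_divisors // => /(dvdn_gt0 L0) m0.
  rewrite /w; case: ifP => _; last by rewrite mul0r.
  by rewrite expr_div_n mulrA mulVf ?mul1r // expf_neq0 // pnatr_eq0 -lt0n.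
have w0 n : 0 <= w n by rewrite /w; case: ifP => //; rewrite invr_ge0 sqr_ge0.
apply: sum_sqr_ratio_le => // d d0.
have dR : 0 < d%:R :> K by rewrite ltr0n.
rewrite -big_filter.
apply: le_trans (_ : _ <= \sum_(m <- [seq (d * k)%N | k <- index_iota 1 L.+1])
    w m) _.
  apply: ler_sum_subset; rewrite ?filter_uniq ?iota_uniq //.
  - rewrite map_inj_uniq ?iota_uniq // => a b /eqP.
    by rewrite eqn_pmul2l // => /eqP.
  - move=> m; rewrite mem_filter mem_index_iota => /andP[/dvdnP[k ->]] h.
    by apply/mapP; exists k; [rewrite mem_index_iota; nia|rewrite mulnC].
rewrite big_map /w -big_mkcond.
have -> : \sum_(1 <= k < L.+1 | y < (d * k)%:R) ((d * k)%:R ^+ 2)^-1 =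
   (d%:R ^+ 2)^-1 * \sum_(1 <= k < L.+1 | y / d%:R < k%:R) (k%:R ^+ 2)^-1 :> K.
  rewrite mulr_sumr; apply: eq_big => [k|k _].
    by rewrite ltr_pdivrMr // natrM mulrC.
  by rewrite natrM exprMn invfM.
apply: le_trans (ler_wpM2l _ (sum_inv_sqr_tail _ (divr_gt0 y0 dR))) _.
  by rewrite invr_ge0 sqr_ge0.
by rewrite le_eqVlt; apply/orP; left; apply/eqP; field; rewrite !gt_eqF.
Qed.

(** For squarefree [r], sigma(r) / phi(r) is at most [(r / totient r)^2], since at each prime the
    factors [(1 + p) / (p - 1)] and [(p / (p - 1))^2] differ by [1 / (p - 1)^2]. *)
Lemma sum_sigma_ratio_le (K : realType) L x : squarefree L ->
  \sum_(r <- divisors L | (r <= x)%N)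
     (totient r)%:R^-1 * (\sum_(d <- divisors r) d%:R) <= euler_bound K * x%:R.
Proof.
move=> sL; have L0 := squarefree_gt0 sL.
apply: le_trans (sum_sqr_ratio_upto K x sL).
rewrite big_seq_cond [leRHS]big_seq_cond; apply: ler_sum => r.
rewrite -dvdn_divisors // => /andP[rL _]; have sr := squarefree_dvd sL rL.
rewrite (eq_big_seq (fun d => \prod_(p <- primes d) p%:R)); last first.
  move=> d; rewrite -dvdn_divisors ?(squarefree_gt0 sr) // => dr.
  by apply: sqf_natr; apply: squarefree_dvd dr.
rewrite sum_div_mult // sqf_ratio // -prodrXl sqf_totient // mulrC -prodf_div.
rewrite big_seq [leRHS]big_seq; apply: ler_prod => p /prime_in_primes pp.
have p1 := prime_pred_gt0 K pp; have p0 : 0 < p%:R :> K by rewrite ltr0n prime_gt0.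
rewrite divr_ge0 ?(ltW p1) ?addr_ge0 ?(ltW p0) //= -subr_ge0.
have -> : (p%:R / (p%:R - 1)) ^+ 2 - (1 + p%:R) / (p%:R - 1) = (1 / (p%:R - 1)) ^+ 2 :> K.
  by field; rewrite gt_eqF.
exact: sqr_ge0.
Qed.

(** * Tail sums and the effect of the primes dividing [B] *)

Lemma coprime_squarefreeM m n : squarefree (m * n) -> coprime m n.
Proof.
move=> smn; have := squarefree_gt0 smn; rewrite muln_gt0 => /andP[m0 n0].
rewrite coprime_has_primes //; apply/hasPn => p pn; apply/negP => pm.
have pp := prime_in_primes pn.
have /(_ p pp) := elimT (squarefreeP (squarefree_gt0 smn)) smn.
rewrite lognM // leqNgt => /negP; apply.
move: pn pm; rewrite -!logn_gt0; lia.
Qed.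

(* The local factor, at a prime dividing [r], of the contribution of [r] to the
   truncation error; [B] stands for [j * q]. *)
Definition tail_factor (K : realType) (B p : nat) : K :=
  (p%:R - 1)^-1 * (if (p %| B)%N then 1 else (p%:R - 1)^-1).

Lemma tail_factor_coprime (K : realType) B L (y : K) : squarefree L ->
  coprime L B -> 0 < y ->
  \sum_(r <- divisors L | y < r%:R) \prod_(p <- primes r) tail_factor K B p
    <= euler_bound K * (2 / y).
Proof.
move=> sL cLB y0; have L0 := squarefree_gt0 sL.
apply: le_trans (sum_inv_sqr_totient_tail sL y0).
rewrite big_seq_cond [leRHS]big_seq_cond; apply: ler_sum => r.
rewrite -dvdn_divisors // => /andP[rL _]; have sr := squarefree_dvd sL rL.
rewrite sqf_totient // -prodrXl -prodfV le_eqVlt; apply/orP; left; apply/eqP.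
apply: eq_big_seq => p; rewrite /tail_factor mem_primes => /and3P[pp _ pr].
rewrite ifN; first by rewrite expr2 invfM.
by rewrite -prime_coprime //; apply: coprime_dvdl cLB; apply: dvdn_trans rL.
Qed.

(** Adding a prime [p] of [B] creates the terms [p * i], with weight [1 / (p - 1)] and threshold
    [y / p]. The lower threshold costs a factor [p], so each prime costs [1 + p / (p - 1)]. *)
Lemma tail_factorM (K : realType) B D L (y : K) : squarefree D -> squarefree L ->
  coprime D L -> (D %| B)%N -> coprime L B -> 0 < y ->
  \sum_(r <- divisors (D * L) | y < r%:R) \prod_(p <- primes r) tail_factor K B p
    <= euler_bound K * (2 / y) * \prod_(p <- primes D) (1 + p%:R / (p%:R - 1)).
Proof.
move=> sD sL + + cLB; have L0 := squarefree_gt0 sL.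
(* [y] stays general: the induction hypothesis is applied at [y] and at [y / p]. *)
elim/squarefree_ind: D / sD y => [|p D pp cpD sD IH] y cDL DB y0.
  by rewrite mul1n big_nil mulr1 tail_factor_coprime.
have D0 := squarefree_gt0 sD; have DL0 : (0 < D * L)%N by rewrite muln_gt0 D0.
move: cDL; rewrite coprimeMl => /andP[cpL cDL].
have cpDL : coprime p (D * L) by rewrite coprimeMr cpD.
have pB : (p %| B)%N by apply: dvdn_trans DB; apply: dvdn_mulr.
have DB' : (D %| B)%N by apply: dvdn_trans DB; apply: dvdn_mull.
have p1 := prime_pred_gt0 K pp; have p0 : 0 < p%:R :> K by rewrite ltr0n prime_gt0.
rewrite -mulnA big_mkcond big_divisorsM // -!big_mkcond /=.
set X := \prod_(p0 <- primes D) (1 + p0%:R / (p0%:R - 1)) in IH *.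
have -> : \sum_(i <- divisors (D * L) | y < (p * i)%:R)
     \prod_(p0 <- primes (p * i)) tail_factor K B p0 =
   (p%:R - 1)^-1 * \sum_(i <- divisors (D * L) | y / p%:R < i%:R)
     \prod_(p0 <- primes i) tail_factor K B p0.
  rewrite mulr_sumr big_seq_cond [RHS]big_seq_cond; apply: eq_big => [i|i].
    by rewrite ltr_pdivrMr // natrM [p%:R * _]mulrC.
  rewrite -dvdn_divisors // => /andP[iDL _].
  have cpi : coprime p i by apply: coprime_dvdr cpDL.
  rewrite (perm_big _ (perm_primesM pp cpi (dvdn_gt0 DL0 iDL))) /= big_cons.
  by rewrite {1}/tail_factor pB mulr1.
apply: le_trans (lerD (IH _ cDL DB' y0)
   (ler_wpM2l _ (IH _ cDL DB' (divr_gt0 y0 p0)))) _.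
  by rewrite invr_ge0 ltW.
rewrite (perm_big _ (perm_primesM pp cpD D0)) /= big_cons -/X.
rewrite le_eqVlt; apply/orP; left; apply/eqP; field.
by rewrite !gt_eqF.
Qed.

Lemma prod_primes_ge_gcd (K : realType) L B : (0 < B)%N ->
  \prod_(p <- primes (gcdn L B)) (1 + p%:R / (p%:R - 1)) <=
  \prod_(p <- primes B) (1 + p%:R / (p%:R - 1)) :> K.
Proof.
move=> B0; rewrite (prod_primes_dvd _ B0 (dvdn_gcdr _ _)).
rewrite big_seq [leRHS]big_seq; apply: ler_prod => p /prime_in_primes pp.
have p1 := prime_pred_gt0 K pp.
have h : 0 <= p%:R / (p%:R - 1) :> K by rewrite divr_ge0 // ltW.
by case: ifP => _; rewrite ?lexx ?lerDl ?addr_ge0 // ler01.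
Qed.

(** As [L] is squarefree, it splits into [gcdn L B] and a cofactor coprime to [B]. *)
Lemma tail_factor_sum (K : realType) B L (y : K) : squarefree L -> (0 < B)%N -> 0 < y ->
  \sum_(r <- divisors L | y < r%:R) \prod_(p <- primes r) tail_factor K B p
    <= euler_bound K * (2 / y) * \prod_(p <- primes B) (1 + p%:R / (p%:R - 1)).
Proof.
move=> sL B0 y0; have L0 := squarefree_gt0 sL.
pose D := gcdn L B; have DL : (D %| L)%N by apply: dvdn_gcdl.
have E : L = (D * (L %/ D))%N by rewrite mulnC divnK.
have sM : squarefree (D * (L %/ D)) by rewrite -E.
have cD := coprime_squarefreeM sM.
have sD := squarefree_dvd sL DL.
have sL' : squarefree (L %/ D) by apply: squarefree_dvd sM _; apply: dvdn_mull.
have cB : coprime (L %/ D) B.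
  rewrite /coprime -dvdn1 -(eqP cD) dvdn_gcd dvdn_gcdl andbT /D dvdn_gcd.
  rewrite dvdn_gcdr andbT; apply: dvdn_trans (dvdn_gcdl _ _) _.
  by apply/dvdnP; exists D.
rewrite {1}E; apply: le_trans (tail_factorM sD sL' cD (dvdn_gcdr _ _) cB y0) _.
apply: ler_wpM2l; last exact: prod_primes_ge_gcd.
by rewrite mulr_ge0 ?expR_ge0 // divr_ge0 // ltW.
Qed.

(** * Products over primes against the totient and divisor functions *)

Lemma totient_ratio (K : realType) n : (0 < n)%N ->
  n%:R / (totient n)%:R = \prod_(p <- primes n) (p%:R / (p%:R - 1)) :> K.
Proof.
move=> n0; rewrite totientE // {1}[n]prod_prime_decomp // prime_decompE big_map /=.
rewrite !natr_prod -prodf_div; apply: eq_big_seq => p pn.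
have pp := prime_in_primes pn; have p1 := prime_pred_gt0 K pp.
have p0 : p%:R != 0 :> K by rewrite pnatr_eq0 -lt0n prime_gt0.
move: pn; rewrite -logn_gt0; case: (logn p n) => // k _.
rewrite expnS !natrM natrX /= -subn1 natrB ?prime_gt0 //.
by field; rewrite expf_neq0 // gt_eqF.
Qed.

(** The left side counts the divisors of the radical of [n], all of which divide [n]. *)
Lemma exp2_primes_le (K : realType) n : (0 < n)%N ->
  \prod_(p <- primes n) 2 <= (num_divisors n)%:R :> K.
Proof.
move=> n0; have ap : all prime (primes n) by apply/allP => p /prime_in_primes.
have [sf pe] := squarefree_prod_seq (primes_uniq n) ap.
set m := (\prod_(p <- primes n) p)%N in sf pe.
have mn : (m %| n)%N.
  rewrite sqf_dvd // (perm_all _ pe); apply/allP => p.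
  by rewrite mem_primes => /and3P[].
have : (size (divisors m) <= size (divisors n))%N.
  apply: uniq_leq_size; first exact: divisors_uniq.
  move=> d; rewrite -!dvdn_divisors // ?(squarefree_gt0 sf) // => dm.
  exact: dvdn_trans mn.
rewrite -(ler_nat K); apply: le_trans; rewrite -(perm_big _ pe) /=.
have <- := sum_div_mult (fun=> 1 : K) sf.
by rewrite -sum1_size natr_sum; apply: ler_sum => d _; rewrite big1.
Qed.

Lemma prod_primes_le_divisors (K : realType) n : (0 < n)%N ->
  \prod_(p <- primes n) (1 + p%:R / (p%:R - 1)) <=
  n%:R * (num_divisors n)%:R / (totient n)%:R :> K.
Proof.
move=> n0; rewrite mulrAC totient_ratio // mulrC.
have R0 : 0 <= \prod_(p <- primes n) (p%:R / (p%:R - 1)) :> K.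
  by rewrite -totient_ratio // divr_ge0.
apply: le_trans (ler_wpM2r R0 (exp2_primes_le K n0)); rewrite -big_split /=.
rewrite big_seq [leRHS]big_seq; apply: ler_prod => p /prime_in_primes pp.
have p1 := prime_pred_gt0 K pp; have p0 : 0 < p%:R :> K by rewrite ltr0n prime_gt0.
rewrite addr_ge0 ?divr_ge0 ?ler01 ?(ltW p0) ?(ltW p1) //=.
have : 1 <= p%:R / (p%:R - 1) :> K by rewrite ler_pdivlMr // mul1r gerBl.
by lra.
Qed.

Lemma prod_primes_mul_le (K : realType) m n : (0 < m)%N -> (0 < n)%N ->
  \prod_(p <- primes (m * n)) (1 + p%:R / (p%:R - 1)) <=
  \prod_(p <- primes m) (1 + p%:R / (p%:R - 1)) *
  \prod_(p <- primes n) (1 + p%:R / (p%:R - 1)) :> K.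
Proof.
move=> m0 n0; have mn0 : (0 < m * n)%N by rewrite muln_gt0 m0.
rewrite (prod_primes_dvd _ mn0 (dvdn_mulr n (dvdnn m))).
rewrite (prod_primes_dvd _ mn0 (dvdn_mull m (dvdnn n))) -big_split /=.
rewrite big_seq [leRHS]big_seq; apply: ler_prod => p pmn.
have pp := prime_in_primes pmn; have p1 := prime_pred_gt0 K pp.
have h : 0 <= p%:R / (p%:R - 1) :> K by rewrite divr_ge0 // ltW.
set x := p%:R / _ in h *; rewrite addr_ge0 //=.
move: pmn; rewrite mem_primes Euclid_dvdM // => /and3P[_ _].
have x1 : 1 <= 1 + x by rewrite lerDl.
case: (p %| m)%N => /= [_|->]; last by rewrite mul1r.
by case: ifP => _; rewrite ?mulr1 // ler_peMr // (le_trans ler01).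
Qed.

(** * The Euler product and the truncation error *)

(** The contribution of [r] and [s] to the main term, without the factor [N / q]; the product is the
    inner sum evaluated in [sum_moebius_gcd]. *)
Definition pair_weight (K : realType) (q j L r s : nat) : K :=
  (totient r)%:R^-1 * (totient s)%:R^-1 *
  \prod_(p <- primes L) local_corr K q j p (p %| r)%N (p %| s)%N.

(** The local pair weight at [p], summed over the four choices of whether [p] divides [r] and
    [s]. *)
Definition euler_factor (K : realType) (q j p : nat) : K :=
  if (p %| q)%N then (p%:R / (p%:R - 1)) ^+ 2
  else if (p %| j)%N then p%:R / (p%:R - 1) else 1 - 1 / (p%:R - 1) ^+ 2.

Lemma inv_totient_prod (K : realType) L r : squarefree L -> (r %| L)%N ->
  (totient r)%:R^-1 =
  \prod_(p <- primes L) (if (p %| r)%N then (p%:R - 1)^-1 else 1) :> K.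
Proof.
move=> sL rL; rewrite sqf_totient ?(squarefree_dvd sL rL) // -prodfV.
by rewrite (prod_primes_dvd _ (squarefree_gt0 sL) rL).
Qed.

Lemma pair_weightC (K : realType) q j L r s :
  pair_weight K q j L r s = pair_weight K q j L s r.
Proof.
rewrite /pair_weight [_^-1 * _^-1]mulrC; congr (_ * _); apply: eq_bigr => p _.
by rewrite /local_corr andbC orbC.
Qed.

Lemma sum_pair_weight (K : realType) q j L : squarefree L ->
  \sum_(r <- divisors L) \sum_(s <- divisors L) pair_weight K q j L r s =
  \prod_(p <- primes L) euler_factor K q j p.
Proof.
move=> sL; have L0 := squarefree_gt0 sL.
pose u p (b b' : bool) : K := (if b then (p%:R - 1)^-1 else 1) *
  (if b' then (p%:R - 1)^-1 else 1) * local_corr K q j p b b'.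
transitivity (\sum_(r <- divisors L) \prod_(p <- primes L)
    (u p (p %| r)%N false + u p (p %| r)%N true)).
  apply: eq_big_seq => r; rewrite -dvdn_divisors // => rL.
  rewrite -(sum_div_prod (fun p b' => u p (p %| r)%N b') sL).
  apply: eq_big_seq => s; rewrite -dvdn_divisors // => sL'.
  by rewrite /pair_weight !(inv_totient_prod K sL) // -!big_split.
rewrite (sum_div_prod (fun p b => u p b false + u p b true) sL).
apply: eq_big_seq => p /prime_in_primes pp; have p1 := prime_pred_gt0 K pp.
rewrite /u /local_corr /euler_factor /=.
by case: (p %| q)%N; case: (p %| j)%N => /=; field; rewrite gt_eqF.
Qed.

Lemma prod_primes_sub (K : comNzRingType) (F : nat -> K) n L : (0 < n)%N ->
  {subset primes n <= primes L} ->
  \prod_(p <- primes n) F p = \prod_(p <- primes L) (if (p %| n)%N then F p else 1).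
Proof.
move=> n0 nL; rewrite -big_mkcond -[RHS]big_filter; apply: perm_big.
apply: uniq_perm; rewrite ?filter_uniq ?primes_uniq // => p; rewrite mem_filter.
apply/idP/andP => [pn|[pn pL]].
  by split; [move: pn; rewrite mem_primes => /and3P[]|apply: nL].
by rewrite mem_primes n0 pn (prime_in_primes pL).
Qed.

(** Absolute values keep the product structure. A prime dividing [q] gives [p / (p - 1)] whether or
    not it divides [r], and each prime dividing [r] gives in addition its [tail_factor]. *)
Lemma sum_norm_pair_weight (K : realType) q j L r : squarefree L -> (r %| L)%N ->
  (0 < q)%N -> {subset primes q <= primes L} ->
  \sum_(s <- divisors L) `|pair_weight K q j L r s| =
  q%:R / (totient q)%:R * \prod_(p <- primes r) tail_factor K (j * q) p.
Proof.
move=> sL rL q0 qL; have L0 := squarefree_gt0 sL.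
pose u p (b' : bool) : K := (if (p %| r)%N then (p%:R - 1)^-1 else 1) *
  (if b' then (p%:R - 1)^-1 else 1) * `|local_corr K q j p (p %| r)%N b'|.
transitivity (\sum_(s <- divisors L) \prod_(p <- primes L) u p (p %| s)%N).
  apply: eq_big_seq => s; rewrite -dvdn_divisors // => sL'.
  rewrite /pair_weight !normrM !normfV !normr_nat.
  by rewrite normr_prod !(inv_totient_prod K sL) // -!big_split.
rewrite sum_div_prod // totient_ratio // (prod_primes_sub _ q0 qL).
rewrite (prod_primes_dvd _ L0 rL) -big_split /=.
apply: eq_big_seq => p /prime_in_primes pp; have p1 := prime_pred_gt0 K pp.
rewrite /u /local_corr /tail_factor Euclid_dvdM //.
have n1 : p%:R - 1 != 0 :> K by rewrite gt_eqF.
case: (p %| r)%N; case: (p %| q)%N; rewrite ?orbT ?orbF;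
  case: (p %| j)%N => /=; rewrite ?(normr0, normr1, mulr1n, mulr0n) ?sub0r ?normrN1;
  rewrite ?(ger0_norm (ltW p1)); by field.
Qed.

(** The discarded pairs have [r] outside [Q], or [r] inside and [s] outside; symmetry bounds the
    second kind by the first, whence the factor 2. *)
Lemma norm_truncate_square (K : realType) (D : seq nat) (Q : pred nat)
    (f : nat -> nat -> K) :
  (forall r s, f r s = f s r) ->
  `| \sum_(r <- D | Q r) \sum_(s <- D | Q s) f r s - \sum_(r <- D) \sum_(s <- D) f r s |
  <= 2 * \sum_(r <- D | ~~ Q r) \sum_(s <- D) `|f r s|.
Proof.
move=> fC.
have -> : \sum_(r <- D) \sum_(s <- D) f r s =
    \sum_(r <- D | Q r) \sum_(s <- D | Q s) f r s +
    \sum_(r <- D | Q r) \sum_(s <- D | ~~ Q s) f r s +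
    \sum_(r <- D | ~~ Q r) \sum_(s <- D) f r s.
  rewrite (bigID Q) /= -big_split /=; congr (_ + _); apply: eq_bigr => r _.
  by rewrite (bigID Q).
rewrite -addrA opprD addNKr normrN.
apply: le_trans (ler_normD _ _) _; rewrite mulr_natl mulr2n; apply: lerD.
  rewrite exchange_big /=; apply: le_trans (ler_norm_sum _ _ _) _.
  apply: ler_sum => s _; apply: le_trans (ler_norm_sum _ _ _) _.
  rewrite big_mkcond; apply: ler_sum => r _; rewrite fC.
  by case: ifP.
apply: le_trans (ler_norm_sum _ _ _) _.
by apply: ler_sum => s _; apply: ler_norm_sum.
Qed.

(** The factor 4 joins the 2 of [norm_truncate_square] to the 2 of the tail bound [2 / R]. The
    product over the primes of [j * q] is split between [q] and [j]. *)
Lemma truncated_pair_sum (K : realType) q j L x (R : K) : squarefree L ->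
  (0 < q)%N -> (0 < j)%N -> {subset primes q <= primes L} -> 0 < R ->
  (forall n, (x < n)%N = (R < n%:R)) ->
  `| \sum_(r <- divisors L | (r <= x)%N) \sum_(s <- divisors L | (s <= x)%N)
        pair_weight K q j L r s
     - \prod_(p <- primes L) euler_factor K q j p |
  <= 4 * euler_bound K * (q%:R / (totient q)%:R) / R * g_factor K q *
     (j%:R * (num_divisors j)%:R / (totient j)%:R).
Proof.
move=> sL q0 j0 qL R0 xR; have L0 := squarefree_gt0 sL.
rewrite -sum_pair_weight //.
apply: le_trans (norm_truncate_square _ (fun r => r <= x)%N (pair_weightC K q j L)) _.
have -> : \sum_(r <- divisors L | ~~ (r <= x)%N)
      \sum_(s <- divisors L) `|pair_weight K q j L r s|
  = q%:R / (totient q)%:R *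
    \sum_(r <- divisors L | R < r%:R) \prod_(p <- primes r) tail_factor K (j * q) p.
  rewrite mulr_sumr big_seq_cond [RHS]big_seq_cond; apply: eq_big => [r|r].
    by rewrite -ltnNge xR.
  rewrite -dvdn_divisors // => /andP[rL _]; exact: sum_norm_pair_weight.
have jq0 : (0 < j * q)%N by rewrite muln_gt0 j0.
have q1 : 0 <= q%:R / (totient q)%:R :> K by rewrite divr_ge0.
have E0 := ltW (expR_gt0 8 : 0 < euler_bound K).
apply: le_trans (_ : _ <= 2 * (q%:R / (totient q)%:R * (euler_bound K * (2 / R) *
   ((j%:R * (num_divisors j)%:R / (totient j)%:R) * g_factor K q)))) _.
  rewrite ler_pM2l // ler_wpM2l //.
  apply: le_trans (tail_factor_sum sL jq0 R0) _.
  apply: ler_wpM2l; first by rewrite mulr_ge0 // divr_ge0 // ltW.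
  apply: le_trans (prod_primes_mul_le K j0 q0) _.
  apply: ler_wpM2r; last exact: prod_primes_le_divisors.
  rewrite big_seq; apply: prodr_ge0 => p /prime_in_primes pp.
  by rewrite addr_ge0 ?divr_ge0 ?ler01 // ltW // prime_pred_gt0.
rewrite le_eqVlt; apply/orP; left; apply/eqP; set J := j%:R * _ / _.
set X := q%:R / _; field; by rewrite gt_eqF.
Qed.

(** * The correlation as a sum over pairs of divisors *)

(* [lambda_R] applied to [n], with the indicator of [d | n] replaced by an
   arbitrary function [X] of [d] *)
Definition lambda_form (K : realType) (L x : nat) (X : nat -> K) : K :=
  \sum_(r <- divisors L | (r <= x)%N) (totient r)%:R^-1 *
    \sum_(d <- divisors r) d%:R * (moebius d)%:~R * X d.

(** The squared Moebius function selects squarefree [r], and those up to [R] are exactly the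
    divisors of [L] in that range. *)
Lemma lambda_R_form (K : realType) (L : nat) (R : K) (n : int) : squarefree L ->
  (forall r, squarefree r -> (r <= Num.truncn R)%N -> (r %| L)%N) ->
  lambda_R R n = lambda_form L (Num.truncn R) (fun d => (d %| `|n|)%N%:R).
Proof.
move=> sL hL; have L0 := squarefree_gt0 sL; rewrite /lambda_R /lambda_form.
set x := Num.truncn R in hL *.
pose G r : K := \sum_(d <- divisors (gcdn r `|n|%N)) d%:R * (moebius d)%:~R.
transitivity (\sum_(r <- index_iota 1 x.+1 | squarefree r) (totient r)%:R^-1 * G r : K).
  rewrite [RHS]big_mkcond; apply: eq_bigr => r _; rewrite /moebius.
  case: ifP => _; last by rewrite rmorph0 expr0n !mul0r.
  by rewrite rmorphXn rmorphN1 sqrr_sign mul1r.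
rewrite -big_filter -[RHS]big_filter.
have pe : perm_eq [seq r <- index_iota 1 x.+1 | squarefree r]
                  [seq r <- divisors L | (r <= x)%N].
  apply: uniq_perm; rewrite ?filter_uniq ?iota_uniq ?divisors_uniq // => r.
  rewrite !mem_filter mem_index_iota -dvdn_divisors // ltnS.
  apply/idP/idP => [/and3P[sr r0 rx]|/andP[rx rL]]; first by rewrite rx hL.
  by rewrite (squarefree_dvd sL rL) (dvdn_gt0 L0 rL) rx.
rewrite (perm_big _ pe) /=; apply: eq_big_seq => r; rewrite mem_filter => /andP[_].
rewrite -dvdn_divisors // => rL; congr (_ * _); have r0 := dvdn_gt0 L0 rL.
rewrite /G (sum_dvd _ r0 (dvdn_gcdl _ _)) big_mkcond.
apply: eq_big_seq => d; rewrite -dvdn_divisors // => dr; rewrite dvdn_gcd dr /=.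
by case: ifP; rewrite ?mulr1 ?mulr0.
Qed.

Definition lambda_coef (K : realType) (L x d : nat) : K :=
  \sum_(r <- divisors L | (r <= x)%N && (d %| r)%N)
    (totient r)%:R^-1 * (d%:R * (moebius d)%:~R).

Lemma lambda_form_coef (K : realType) L x (X : nat -> K) : (0 < L)%N ->
  lambda_form L x X = \sum_(d <- divisors L) lambda_coef K L x d * X d.
Proof.
move=> L0; rewrite /lambda_form /lambda_coef.
rewrite big_seq_cond (eq_bigr (fun r => \sum_(d <- divisors L)
    if (d %| r)%N then (totient r)%:R^-1 * (d%:R * (moebius d)%:~R) * X d
    else 0)); last first.
  move=> r; rewrite -dvdn_divisors // => /andP[rL _].
  rewrite (sum_dvd _ L0 rL) mulr_sumr big_mkcond; apply: eq_bigr => d _.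
  by case: ifP => // _; rewrite mulrA.
rewrite -big_seq_cond exchange_big; apply: eq_bigr => d _ /=.
by rewrite mulr_suml big_mkcondr.
Qed.

Lemma sum_norm_lambda_coef (K : realType) L x : squarefree L ->
  \sum_(d <- divisors L) `|lambda_coef K L x d| <= euler_bound K * x%:R.
Proof.
move=> sL; have L0 := squarefree_gt0 sL.
apply: le_trans (sum_sigma_ratio_le K x sL).
have -> : \sum_(r <- divisors L | (r <= x)%N)
    (totient r)%:R^-1 * (\sum_(d <- divisors r) d%:R) =
  \sum_(r <- divisors L | (r <= x)%N) \sum_(d <- divisors L)
    if (d %| r)%N then (totient r)%:R^-1 * d%:R else 0 :> K.
  rewrite big_seq_cond [RHS]big_seq_cond; apply: eq_bigr => r.
  rewrite -dvdn_divisors // => /andP[rL _].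
  by rewrite (sum_dvd _ L0 rL) mulr_sumr big_mkcond.
rewrite exchange_big; apply: ler_sum => d _ /=.
rewrite -big_mkcondr; apply: le_trans (ler_norm_sum _ _ _) _.
apply: ler_sum => r _; rewrite !normrM normfV !normr_nat.
rewrite ler_wpM2l ?invr_ge0 // ler_piMr // /moebius.
by case: ifP => _; rewrite ?rmorph0 ?normr0 // rmorphXn rmorphN1 normrX normrN1 expr1n.
Qed.

(** Both quantities are bilinear in the coefficients [lambda_coef]. For each pair [d], [e] the
    counts differ by at most 2, so the error is at most twice the square of the sum of absolute
    coefficients. *)
Lemma correlation_sum (K : realType) (q : nat) (a j : int) (N R : K) L :
  squarefree L -> (0 < q)%N -> coprimez a q -> 0 <= N ->
  (forall r, squarefree r -> (r <= Num.truncn R)%N -> (r %| L)%N) ->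
  `| \sum_(1 <= n < (Num.truncn N).+1 | (n%:Z == a %[mod q%:Z])%Z)
        lambda_R R n%:Z * lambda_R R (n%:Z + j * q%:Z)
     - N / q%:R * \sum_(r <- divisors L | (r <= Num.truncn R)%N)
        \sum_(s <- divisors L | (s <= Num.truncn R)%N) pair_weight K q `|j| L r s |
  <= 2 * (euler_bound K * (Num.truncn R)%:R) ^+ 2.
Proof.
move=> sL q0 caq N0 hL; have L0 := squarefree_gt0 sL; set x := Num.truncn R in hL *.
have qR : q%:R != 0 :> K by rewrite pnatr_eq0 -lt0n.
pose c d := lambda_coef K L x d.
pose kap d e : K := ([&& coprime d q, coprime e q & gcdn d e %| `|j|]%N)%:R.
pose cnt d e : K := \sum_(1 <= n < (Num.truncn N).+1 | (n%:Z == a %[mod q%:Z])%Z)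
   (d %| n)%N%:R * (e %| `|(n%:Z + j * q%:Z)%R|)%N%:R.
have -> : \sum_(1 <= n < (Num.truncn N).+1 | (n%:Z == a %[mod q%:Z])%Z)
        lambda_R R n%:Z * lambda_R R (n%:Z + j * q%:Z) =
   \sum_(d <- divisors L) \sum_(e <- divisors L) c d * c e * cnt d e.
  rewrite (eq_bigr (fun n => \sum_(d <- divisors L) \sum_(e <- divisors L)
     c d * c e * ((d %| n)%N%:R * (e %| `|(n%:Z + j * q%:Z)%R|)%N%:R))); last first.
    move=> n _; rewrite !(lambda_R_form _ sL hL) !lambda_form_coef // mulr_suml.
    apply: eq_bigr => d _; rewrite mulr_sumr; apply: eq_bigr => e _.
    by rewrite mulrACA.
  rewrite exchange_big; apply: eq_bigr => d _ /=.
  by rewrite exchange_big; apply: eq_bigr => e _ /=; rewrite -mulr_sumr.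
have -> : N / q%:R * \sum_(r <- divisors L | (r <= x)%N)
        \sum_(s <- divisors L | (s <= x)%N) pair_weight K q `|j| L r s =
   \sum_(d <- divisors L) \sum_(e <- divisors L)
     c d * c e * (kap d e * (N / (q * lcmn d e)%N%:R)).
  transitivity (lambda_form L x (fun d => lambda_form L x (fun e =>
      kap d e * (N / (q * lcmn d e)%N%:R)))); last first.
    rewrite lambda_form_coef //; apply: eq_bigr => d _.
    rewrite lambda_form_coef // mulr_sumr; apply: eq_bigr => e _.
    by rewrite mulrA.
  rewrite /lambda_form mulr_sumr big_seq_cond [RHS]big_seq_cond.
  apply: eq_bigr => r; rewrite -dvdn_divisors // => /andP[rL _].
  under [in RHS]eq_bigr do rewrite mulr_sumr.
  rewrite exchange_big !mulr_sumr /= big_seq_cond [RHS]big_seq_cond.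
  apply: eq_bigr => s; rewrite -dvdn_divisors // => /andP[sL' _].
  rewrite /pair_weight -(sum_moebius_gcd K q `|j| sL rL sL') !mulr_sumr.
  apply: eq_big_seq => d; rewrite -dvdn_divisors ?(dvdn_gt0 L0 rL) // => dr.
  rewrite !mulr_sumr; apply: eq_big_seq => e.
  rewrite -dvdn_divisors ?(dvdn_gt0 L0 sL') // => es.
  have d0 : (0 < d)%N by apply: dvdn_gt0 dr; apply: dvdn_gt0 rL.
  have e0 : (0 < e)%N by apply: dvdn_gt0 es; apply: dvdn_gt0 sL'.
  have l0 : (lcmn d e)%:R != 0 :> K by rewrite pnatr_eq0 -lt0n lcmn_gt0 d0.
  rewrite -/(kap d e) natrM.
  (* This identity turns [d * e / lcmn d e] into the gcd weight of [sum_moebius_gcd]. *)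
  have gl : d%:R * e%:R = (lcmn d e)%:R * (gcdn d e)%:R :> K.
    by rewrite -!natrM muln_lcm_gcd.
  have -> : N / (q%:R * (lcmn d e)%:R) = N / q%:R * (lcmn d e)%:R^-1.
    by rewrite invfM mulrA.
  have -> : (gcdn d e)%:R = d%:R * e%:R * (lcmn d e)%:R^-1 :> K.
    by rewrite gl mulrAC mulfV // mul1r.
  ring.
rewrite -sumrB; under eq_bigr do rewrite -sumrB.
apply: le_trans (ler_norm_sum _ _ _) _.
apply: le_trans (_ : _ <= \sum_(d <- divisors L) \sum_(e <- divisors L)
    `|c d| * `|c e| * 2) _.
  rewrite big_seq [leRHS]big_seq; apply: ler_sum => d.
  rewrite -dvdn_divisors // => dL.
  apply: le_trans (ler_norm_sum _ _ _) _.
  rewrite big_seq [leRHS]big_seq; apply: ler_sum => e.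
  rewrite -dvdn_divisors // => eL.
  rewrite -mulrBr !normrM ler_wpM2l ?mulr_ge0 //.
  apply: count_corr => //; [exact: dvdn_gt0 dL|exact: dvdn_gt0 eL|].
  exact: truncn_itv.
rewrite (eq_bigr (fun d => `|c d| * \sum_(e <- divisors L) `|c e| * 2)); last first.
  by move=> d _; rewrite mulr_sumr; apply: eq_bigr => e _; rewrite mulrA.
rewrite -mulr_suml -mulr_suml mulrA -expr2 mulrC ler_pM2l //.
have S := sum_norm_lambda_coef K x sL.
by rewrite lerXn2r ?nnegrE ?(le_trans _ S) // sumr_ge0.
Qed.

(** * Passage to the limit *)

Definition primorial (n : nat) : nat := (\prod_(0 <= p < n | prime p) p)%N.

Lemma primorialP n : squarefree (primorial n) /\
  perm_eq (primes (primorial n)) [seq p <- index_iota 0 n | prime p].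
Proof.
rewrite /primorial -big_filter; apply: squarefree_prod_seq.
  by rewrite filter_uniq // iota_uniq.
exact: filter_all.
Qed.

Lemma dvdn_primorial n r : squarefree r -> (r < n)%N -> (r %| primorial n)%N.
Proof.
move=> sr rn; rewrite sqf_dvd //; apply/allP => p pr.
have [sL pe] := primorialP n.
have : p \in primes (primorial n).
  rewrite (perm_mem pe) mem_filter (prime_in_primes pr) mem_index_iota /=.
  move: pr; rewrite mem_primes => /and3P[_ r0 /(dvdn_leq r0) pr].
  exact: leq_ltn_trans rn.
by rewrite mem_primes => /and3P[].
Qed.

Lemma primes_sub_primorial n m : (m < n)%N -> {subset primes m <= primes (primorial n)}.
Proof.
move=> mn p pm; have [_ pe] := primorialP n; rewrite (perm_mem pe) mem_filter.
rewrite (prime_in_primes pm) mem_index_iota /=.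
by move: pm; rewrite mem_primes => /and3P[_ m0 /(dvdn_leq m0) /leq_ltn_trans]; apply.
Qed.

Definition twin_prime_prod (K : realType) (m : nat) : K :=
  \prod_(3 <= p < m | prime p) (1 - 1 / (p%:R - 1) ^+ 2).

Lemma twin_prime_factor (K : realType) p :
  prime p -> 0 <= (1 - 1 / (p%:R - 1) ^+ 2 : K) <= 1.
Proof.
move=> pp; have p1 := prime_pred_gt0 K pp.
rewrite subr_ge0 gerBl divr_ge0 ?sqr_ge0 // andbT ler_pdivrMr ?exprn_gt0 // mul1r.
have : 2 <= p%:R :> K by rewrite ler_nat prime_gt1.
by rewrite expr_ge1 ?(ltW p1) //; lra.
Qed.

Lemma twin_prime_prod_ge0 (K : realType) m : 0 <= twin_prime_prod K m.
Proof. by apply: prodr_ge0 => p /(twin_prime_factor K)/andP[]. Qed.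

(** The factors lie between 0 and 1, so the partial products decrease and are bounded below; the
    [lim] in [twin_prime_constant] is therefore a genuine limit. *)
Lemma twin_prime_prod_cvg (K : realType) :
  twin_prime_prod K n @[n --> \oo] --> twin_prime_constant K.
Proof.
apply: nonincreasing_is_cvgn; last first.
  by exists 0 => _ [m _ <-]; apply: twin_prime_prod_ge0.
apply/nonincreasing_seqP => m; rewrite /twin_prime_prod.
have [m3|m3] := leqP 3 m; last by rewrite !big_geq // ltnW.
rewrite big_mkcond [leRHS]big_mkcond big_nat_recr //= ler_piMr //.
  rewrite -big_mkcond; exact: twin_prime_prod_ge0.
by case: ifP => // /(twin_prime_factor K)/andP[].
Qed.

(** Only the infinite product is cut off at [m]; the product over the primes of [k] stays
    complete. *)
Definition singular_approx (K : realType) (m k : nat) : K :=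
  if (2 %| k)%N then
    2 * twin_prime_prod K m *
    \prod_(p <- primes k | (2 < p)%N) ((p%:R - 1) / (p%:R - 2))
  else 0.

Lemma singular_approx_cvg (K : realType) (k : int) :
  singular_approx K n `|k|%N @[n --> \oo] --> singular_series K k.
Proof.
rewrite /singular_series /singular_approx dvdzE /=; case: ifP => _; last exact: cvg_cst.
by apply: cvgMr_tmp; apply: cvgMl_tmp; apply: twin_prime_prod_cvg.
Qed.

(** Splitting off [p / (p - 1)] at each prime of [q] gives [q / totient q] and leaves [w], which
    depends only on whether [p] divides [j * q]. At odd such [p], [p / (p - 1)] is the twin prime
    factor times [(p - 1) / (p - 2)]. *)
Lemma prod_euler_factor (K : realType) q j m : (0 < q)%N -> (0 < j)%N ->
  (2 < m)%N -> (j * q < m)%N ->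
  \prod_(p <- primes (primorial m)) euler_factor K q j p =
  q%:R / (totient q)%:R * singular_approx K m (j * q).
Proof.
move=> q0 j0 m2 jqm; have [sL pe] := primorialP m.
have B0 : (0 < j * q)%N by rewrite muln_gt0 j0.
have qm : (q < m)%N by apply: leq_ltn_trans jqm; rewrite leq_pmull.
rewrite totient_ratio // (prod_primes_sub _ q0 (primes_sub_primorial qm)).
pose w p : K := if (p %| j * q)%N then p%:R / (p%:R - 1) else 1 - 1 / (p%:R - 1) ^+ 2.
have -> : \prod_(p <- primes (primorial m)) euler_factor K q j p =
   \prod_(p <- primes (primorial m)) (if (p %| q)%N then p%:R / (p%:R - 1) else 1) *
   \prod_(p <- primes (primorial m)) w p.
  rewrite -big_split /=; apply: eq_big_seq => p /prime_in_primes pp.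
  rewrite /euler_factor /w Euclid_dvdM //.
  by case: (p %| q)%N; case: (p %| j)%N; rewrite ?mul1r ?expr2.
congr (_ * _); rewrite (perm_big _ pe) /= big_filter /singular_approx.
rewrite (@big_cat_nat _ _ _ 3) //= (_ : index_iota 0 3 = [:: 0; 1; 2]%N) //.
rewrite 3!big_cons big_nil /= mulr1.
(* The prime 2 decides parity: its factor is [1 - 1 = 0] when [j * q] is odd, and 2 when it is
   even. *)
rewrite {1}/w; case: ifP => h2; last first.
  by rewrite [X in X ^+ 2](_ : _ = 1) ?expr1n ?divr1 ?subrr ?mul0r //; lra.
rewrite [2 - 1](_ : _ = 1 :> K) ?divr1; last lra.
rewrite -mulrA; congr (_ * _).
have pB : perm_eq [seq p <- primes (j * q) | (2 < p)%N]
    [seq p <- index_iota 3 m | prime p && (p %| j * q)%N].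
  apply: uniq_perm; rewrite ?filter_uniq ?primes_uniq ?iota_uniq // => p.
  rewrite !mem_filter mem_primes B0 mem_index_iota /=.
  apply/idP/idP => [/and3P[p2 pp pB]|/and3P[/andP[pp pB] p2 _]]; last by rewrite p2 pp.
  by rewrite pp pB p2 /=; apply: leq_ltn_trans jqm; apply: dvdn_leq.
rewrite -[\prod_(p <- primes _ | _) _]big_filter (perm_big _ pB) /=.
rewrite big_filter big_mkcondr -big_split /=.
rewrite big_nat_cond [RHS]big_nat_cond.
apply: eq_bigr => p /andP[/andP[p3 _] pp]; rewrite /w.
case: ifP => _; last by rewrite mulr1.
have [p1 p2] : p%:R - 1 != 0 :> K /\ p%:R - 2 != 0 :> K.
  by split; rewrite subr_eq0 ?(eqr_nat _ _ 1) ?(eqr_nat _ _ 2) gtn_eqF // ltnW.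
by field; rewrite p1 p2.
Qed.

Theorem proposition4 (K : realType) :
  exists c1 c2 : K,
  forall (q : nat) (a j : int) (N R : K),
    (1 <= q)%N -> coprimez a q%:Z -> j != 0 -> 1 <= N -> 1 <= R ->
    `| \sum_(1 <= n < (Num.truncn N).+1 | (n%:Z == a %[mod q%:Z])%Z)
          lambda_R R n%:Z * lambda_R R (n%:Z + j * q%:Z)
       - N / (totient q)%:R * singular_series K (j * q%:Z) |
    <= c1 * (N * g_factor K q / ((totient q)%:R * R) *
             ((`|j|%N)%:R * (num_divisors `|j|%N)%:R / (totient `|j|%N)%:R))
       + c2 * R ^+ 2.
Proof.
exists (4 * euler_bound K), (2 * euler_bound K ^+ 2) => q a j N R q0 caq j0 N1 R1.
have N0 : 0 <= N by apply: le_trans N1.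
have R0 : 0 < R by apply: lt_le_trans R1.
have J0 : (0 < `|j|)%N by rewrite absz_gt0.
set A := \sum_(1 <= n < _ | _) _; set E := (X in _ <= X).
(* The bound [E] does not involve [m], so it passes to the limit once it holds for all large [m]. *)
pose f m := `|A - N / (totient q)%:R * singular_approx K m `|j * q%:Z| |.
have fcvg : f m @[m --> \oo] -->
    `|A - N / (totient q)%:R * singular_series K (j * q%:Z)|.
  apply: cvg_norm; apply: cvgB; first exact: cvg_cst.
  by apply: cvgMl_tmp; apply: singular_approx_cvg.
apply: cvgr_to_le fcvg _.
(* Beyond this bound the primorial contains the prime 2 and every prime of [j * q], and is divisible
   by every squarefree [r] up to [R]. *)
exists (maxn 3 (maxn (`|j| * q).+1 (Num.truncn R).+1)) => // m /=.
rewrite !geq_max => /and3P[m3 jqm Rm]; rewrite /f abszM /=.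
have [sL _] := primorialP m.
have hL r : squarefree r -> (r <= Num.truncn R)%N -> (r %| primorial m)%N.
  by move=> sr rR; apply: dvdn_primorial => //; apply: leq_ltn_trans Rm.
have qL : {subset primes q <= primes (primorial m)}.
  by apply: primes_sub_primorial; apply: leq_ltn_trans jqm; rewrite leq_pmull.
have := correlation_sum j sL q0 caq N0 hL; rewrite -/A.
have xR n : (Num.truncn R < n)%N = (R < n%:R) by rewrite truncn_lt_nat // ltW.
have := truncated_pair_sum sL q0 J0 qL R0 xR; rewrite prod_euler_factor //.
set S := \sum_(r <- _ | _) _; set s := singular_approx _ _ _.
set x := (Num.truncn R)%:R; have xR' : x <= R by rewrite /x truncn_le ltW.
have qR : 0 < q%:R :> K by rewrite ltr0n.
have tR : 0 < (totient q)%:R :> K by rewrite ltr0n totient_gt0.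
have E0 := expR_gt0 8 : 0 < euler_bound K.
move=> hS hA.
(* The first bracket is the counting error, giving the [R ^+ 2] term; the second is the truncation
   error. *)
have -> : A - N / (totient q)%:R * s =
   (A - N / q%:R * S) + N / q%:R * (S - q%:R / (totient q)%:R * s).
  by field; rewrite !gt_eqF.
apply: le_trans (ler_normD _ _) _; rewrite addrC; apply: lerD.
  rewrite normrM ger0_norm ?divr_ge0 //.
  apply: le_trans (ler_wpM2l _ hS) _; first by rewrite divr_ge0.
  rewrite le_eqVlt; apply/orP; left; apply/eqP.
  by set X := `|j|%:R * _ / _; field; rewrite !gt_eqF.
apply: le_trans hA _; rewrite -mulrA ler_pM2l // exprMn ler_pM2l ?exprn_gt0 //.
by rewrite lerXn2r ?nnegrE // ltW.
Qed.
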